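(* Let $H$ be a weak Hopf algebra over a field $\Bbbk$ and let $C$ be a $\Bbbk$-coalgebra. Suppose there is a linear map $\rho: C\to H\otimes C$, written $\rho(c)=c^{-1}\otimes c^{0}$, such that for all $c\in C$: (CC1) $(\varepsilon_H\otimes I_C)\rho(c)=c$; (CC2) $(I_H\otimes\Delta_C)\rho(c)=(m_H\otimes I_C\otimes I_C)(I_H\otimes\tau_{C,H}\otimes I_C)(\rho\otimes\rho)\Delta_C(c)$; (CC3) $(I_H\otimes\rho)\rho(c)=(\Delta_H\otimes I_C)\rho(c)$. Then for all $c\in C$: (CC4) $(I_H\otimes\varepsilon_C)\rho(c)=(\varepsilon_t\otimes\varepsilon_C)\rho(c)$.
   Context: All tensor products are over the field $\Bbbk$, all maps are $\Bbbk$-linear, and $V\otimes\Bbbk\simeq V\simeq\Bbbk\otimes V$ is used as an identification; coalgebras are coassociative and counital; Sweedler notation $\Delta(h)=h_1\otimes h_2$ is used, and $\tau_{V,W}:V\otimes W\to W\otimes V$ is the flip. $I_V$ is the identity map of $V$. A weak bialgebra $(H,m,u,\Delta,\varepsilon)$ is a vector space that is both an algebra and a coalgebra such that for all $h,k,\ell\in H$: (i) $\Delta(hk)=\Delta(h)\Delta(k)$; (ii) $\varepsilon(hk\ell)=\varepsilon(hk_1)\varepsilon(k_2\ell)=\varepsilon(hk_2)\varepsilon(k_1\ell)$; (iii) $(1_H\otimes\Delta(1_H))(\Delta(1_H)\otimes 1_H)=(\Delta(1_H)\otimes 1_H)(1_H\otimes\Delta(1_H))=\Delta^2(1_H)$,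 where $\Delta^2=(\Delta\otimes I)\Delta$. With $\Delta(1_H)=1_1\otimes 1_2$, define $\varepsilon_t(h)=\varepsilon(1_1h)1_2$ and $\varepsilon_s(h)=1_1\varepsilon(h1_2)$. A weak Hopf algebra is a weak bialgebra with a linear map $S:H\to H$ (antipode) such that $h_1S(h_2)=\varepsilon_t(h)$, $S(h_1)h_2=\varepsilon_s(h)$, $S(h_1)h_2S(h_3)=S(h)$ for all $h\in H$. *)

(* Defs.v *)
From HB Require Import structures.
From mathcomp Require Import all_boot all_algebra.
(* boolp turns the relation defining the tensor product into a boolean. *)
From mathcomp Require Import boolp.

Set Implicit Arguments.
Unset Strict Implicit.
Unset Printing Implicit Defensive.

Import GRing.Theory.

Reserved Notation "V '\ox' W" (at level 40, left associativity).
Reserved Notation "v '\ot' w" (at level 40, left associativity).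
Reserved Notation "x '\m' y" (at level 40, left associativity).
Reserved Notation "'\sw_' ( a , b <- t ) E"
  (at level 41, E at level 41, a name, b name, t at level 50,
   format "'\sw_' ( a ,  b  <-  t )  E").

Local Open Scope quotient_scope.
Local Open Scope ring_scope.

(* Tensor product of arbitrary (possibly infinite-dimensional) vector spaces:
   a formal sum v1 (x) w1 + ... + vn (x) wn is the list of the pairs (vi, wi),
   and formal sums are identified modulo the congruence generated by the
   bilinearity relations.  No formal scalars or opposites are needed, since they
   can be moved into the left factors. *)
Section Tensor.
Context (K : fieldType) (V W : lmodType K).
Implicit Types (s t : seq (V * W)) (v : V) (w : W).

Inductive tens_cong : seq (V * W) -> seq (V * W) -> Prop :=
| TcRefl s : tens_cong s s
| TcSym s t : tens_cong s t -> tens_cong t s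
| TcTrans s t r : tens_cong s t -> tens_cong t r -> tens_cong s r
| TcCat s1 s2 t1 t2 :
    tens_cong s1 t1 -> tens_cong s2 t2 -> tens_cong (s1 ++ s2) (t1 ++ t2)
| TcComm s t : tens_cong (s ++ t) (t ++ s)
| TcZero w : tens_cong [:: (0, w)] [::]
| TcAddl v1 v2 w : tens_cong [:: (v1 + v2, w)] [:: (v1, w); (v2, w)]
| TcAddr v w1 w2 : tens_cong [:: (v, w1 + w2)] [:: (v, w1); (v, w2)]
| TcScale a v w : tens_cong [:: (a *: v, w)] [:: (v, a *: w)].

Definition tens_rel s t : bool := `[< tens_cong s t >].

Lemma tens_rel_refl : reflexive tens_rel.
Proof. by move=> s; apply/asboolP; exact: TcRefl. Qed.

Lemma tens_rel_sym : symmetric tens_rel.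
Proof.
by move=> s t; apply/idP/idP => /asboolP h; apply/asboolP; exact: TcSym.
Qed.

Lemma tens_rel_trans : transitive tens_rel.
Proof.
by move=> t s r /asboolP h1 /asboolP h2; apply/asboolP; exact: TcTrans h1 h2.
Qed.

Canonical tens_equiv := EquivRel tens_rel tens_rel_refl tens_rel_sym tens_rel_trans.

Definition tensor := {eq_quot tens_equiv}.

HB.instance Definition _ := Choice.on tensor.
HB.instance Definition _ := EqQuotient.on tensor.

Lemma tens_pi s t : (\pi_tensor s = \pi_tensor t) <-> tens_cong s t.
Proof.
split; first by move=> /eqmodP /asboolP.
by move=> h; apply/eqmodP/asboolP.
Qed.

Lemma tens_repr s : tens_cong (repr (\pi_tensor s)) s.
Proof. by apply/tens_pi; rewrite reprK. Qed.

Definition pure v w : tensor := \pi_tensor [:: (v, w)].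

Definition scale_seq (a : K) s := [seq (a *: p.1, p.2) | p <- s].

Definition tens_zero : tensor := \pi_tensor [::].
Definition tens_add (x y : tensor) : tensor := \pi_tensor (repr x ++ repr y).
Definition tens_scale (a : K) (x : tensor) : tensor := \pi_tensor (scale_seq a (repr x)).
Definition tens_opp (x : tensor) := tens_scale (-1) x.

Lemma tens_add_pi s t : tens_add (\pi_tensor s) (\pi_tensor t) = \pi_tensor (s ++ t).
Proof. by apply/tens_pi; apply: TcCat; exact: tens_repr. Qed.

Lemma scale_cong a s t :
  tens_cong s t -> tens_cong (scale_seq a s) (scale_seq a t).
Proof.
elim=> {s t}.
- by move=> s; exact: TcRefl.
- by move=> s t _ ih; exact: TcSym.
- by move=> s t r _ h1 _ h2; exact: TcTrans h1 h2.
- by move=> s1 s2 t1 t2 _ h1 _ h2; rewrite /scale_seq !map_cat; exact: TcCat.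
- by move=> s t; rewrite /scale_seq !map_cat; exact: TcComm.
- by move=> w /=; rewrite scaler0; exact: TcZero.
- by move=> v1 v2 w /=; rewrite scalerDr; exact: TcAddl.
- by move=> v w1 w2 /=; exact: TcAddr.
- by move=> b v w /=; rewrite scalerA mulrC -scalerA; exact: TcScale.
Qed.

Lemma tens_scale_pi a s : tens_scale a (\pi_tensor s) = \pi_tensor (scale_seq a s).
Proof. by apply/tens_pi; apply: scale_cong; exact: tens_repr. Qed.

Lemma taddA : associative tens_add.
Proof.
move=> x y z; rewrite -[x]reprK -[y]reprK -[z]reprK.
move: (repr x) (repr y) (repr z) => r s t.
by rewrite (tens_add_pi r s) (tens_add_pi s t) !tens_add_pi catA.
Qed.

Lemma taddC : commutative tens_add.
Proof. by move=> x y; apply/tens_pi; exact: TcComm. Qed.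

Lemma tadd0 : left_id tens_zero tens_add.
Proof. by move=> x; rewrite -[x]reprK tens_add_pi. Qed.

Lemma tscaleDl x a b : tens_scale (a + b) x = tens_add (tens_scale a x) (tens_scale b x).
Proof.
rewrite -[x]reprK !tens_scale_pi tens_add_pi; apply/tens_pi.
elim: (repr x) => [|[v w] s ih] /=; first exact: TcRefl.
apply: (@TcTrans _ ([:: (a *: v, w); (b *: v, w)] ++
         (scale_seq a s ++ scale_seq b s))).
  by rewrite -cat1s; apply: TcCat => //; rewrite scalerDl; exact: TcAddl.
rewrite -[_ :: _ ++ _]cat1s -(cat1s _ (scale_seq b s)) -(cat1s (a *: v, w)) -!catA.
apply: TcCat; first exact: TcRefl.
rewrite !catA; apply: TcCat; [exact: TcComm|exact: TcRefl].
Qed.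

Lemma tscale0 x : tens_scale 0 x = tens_zero.
Proof.
rewrite -[x]reprK tens_scale_pi; apply/tens_pi.
elim: (repr x) => [|[v w] s ih] /=; first exact: TcRefl.
by rewrite -cat1s -[[::]]cats0; apply: TcCat => //; rewrite scale0r; exact: TcZero.
Qed.

Lemma tscale1 : left_id 1 tens_scale.
Proof.
move=> x; rewrite -[x]reprK tens_scale_pi; congr (\pi_tensor _).
by rewrite -[RHS]map_id; apply: eq_map => -[v w] /=; rewrite scale1r.
Qed.

Lemma taddN : left_inverse tens_zero tens_opp tens_add.
Proof.
by move=> x; rewrite -{2}[x]tscale1 /tens_opp -tscaleDl addNr tscale0.
Qed.

HB.instance Definition _ := GRing.isZmodule.Build tensor taddA taddC tadd0 taddN.

Lemma tscaleA a b (x : tensor) : tens_scale a (tens_scale b x) = tens_scale (a * b) x.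
Proof.
rewrite -[x]reprK (tens_scale_pi b) !tens_scale_pi; congr (\pi_tensor _).
by rewrite /scale_seq -map_comp; apply: eq_map => -[v w] /=; rewrite scalerA.
Qed.

Lemma tscaleDr : right_distributive tens_scale +%R.
Proof.
move=> a x y; rewrite -[x]reprK -[y]reprK; move: (repr x) (repr y) => s t.
have -> : \pi_tensor s + \pi_tensor t = \pi_tensor (s ++ t) :> tensor.
  exact: tens_add_pi.
rewrite (tens_scale_pi a s) (tens_scale_pi a t) tens_scale_pi /scale_seq map_cat.
by symmetry; exact: tens_add_pi.
Qed.

HB.instance Definition _ :=
  GRing.Zmodule_isLmodule.Build K tensor tscaleA tscale1 tscaleDr tscaleDl.

Lemma pureE v w : pure v w = \pi_tensor [:: (v, w)].
Proof. by []. Qed.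

Lemma tens_addE s t :
  \pi_tensor s + \pi_tensor t = \pi_tensor (s ++ t) :> tensor.
Proof. exact: tens_add_pi. Qed.

Lemma tens_scaleE a s :
  a *: (\pi_tensor s : tensor) = \pi_tensor (scale_seq a s).
Proof. exact: tens_scale_pi. Qed.

Lemma pure_bilinear : bilinear_for *:%R *:%R pure.
Proof.
split=> [w|v] a.
- move=> v1 v2 /=; rewrite !pureE tens_scaleE tens_addE; apply/tens_pi.
  exact: TcAddl.
- move=> w1 w2 /=; rewrite !pureE tens_scaleE tens_addE; apply/tens_pi.
  apply: TcTrans (TcAddr _ _ _) _.
  by apply: (@TcCat [:: _] _ [:: _]); [apply: TcSym; exact: TcScale|exact: TcRefl].
Qed.

HB.instance Definition _ :=
  bilinear_isBilinear.Build K V W tensor *:%R *:%R pure pure_bilinear.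

Lemma tens_pure_sum (x : tensor) : x = \sum_(p <- repr x) pure p.1 p.2.
Proof.
rewrite -{1}[x]reprK; elim: (repr x) => [|[v w] s ih]; first by rewrite big_nil.
by rewrite big_cons -ih -cat1s -tens_addE.
Qed.

Lemma tens_ind (P : tensor -> Prop) :
    (forall v w, P (pure v w)) -> (forall x y, P x -> P y -> P (x + y)) ->
  P 0 -> forall x, P x.
Proof.
move=> Pp PD P0 x; rewrite [x]tens_pure_sum; elim: (repr x) => [|p s ih].
  by rewrite big_nil.
by rewrite big_cons; exact: PD.
Qed.

(* The Sweedler sum: for x = \sum_i vi (x) wi, sweedler x f is \sum_i f vi wi.  It
   is only meaningful for bilinear f, in which case it does not depend on the
   decomposition of x: see sweedler_pure and sweedler_is_linear. *)
Definition sweedler (U : lmodType K) (x : tensor) (f : V -> W -> U) : U :=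
  \sum_(p <- repr x) f p.1 p.2.
Arguments sweedler {U} x f : simpl never.

Section Lift.
Context (U : lmodType K) (f : V -> W -> U).
Context (bf : bilinear_for *:%R *:%R f).

Let fDl v1 v2 w : f (v1 + v2) w = f v1 w + f v2 w.
Proof. by have := bf.1 w 1 v1 v2 => /=; rewrite !scale1r. Qed.

Let fDr v w1 w2 : f v (w1 + w2) = f v w1 + f v w2.
Proof. by have := bf.2 v 1 w1 w2 => /=; rewrite !scale1r. Qed.

Let f0l w : f 0 w = 0.
Proof. by apply: (addIr (f 0 w)); rewrite -fDl !add0r. Qed.

Let f0r v : f v 0 = 0.
Proof. by apply: (addIr (f v 0)); rewrite -fDr !add0r. Qed.

Let fZl a v w : f (a *: v) w = a *: f v w.
Proof. by have := bf.1 w a v 0 => /=; rewrite addr0 f0l addr0. Qed.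

Let fZr a v w : f v (a *: w) = a *: f v w.
Proof. by have := bf.2 v a w 0 => /=; rewrite addr0 f0r addr0. Qed.

Let sum_cong s t :
  tens_cong s t -> \sum_(p <- s) f p.1 p.2 = \sum_(p <- t) f p.1 p.2.
Proof.
elim=> {s t} //.
- by move=> s t r _ -> _ ->.
- by move=> s1 s2 t1 t2 _ h1 _ h2; rewrite !big_cat h1 h2.
- by move=> s t; rewrite !big_cat /= addrC.
- by move=> w; rewrite big_seq1 big_nil /= f0l.
- by move=> v1 v2 w; rewrite !big_cons !big_nil /= !addr0 fDl.
- by move=> v w1 w2; rewrite !big_cons !big_nil /= !addr0 fDr.
- by move=> a v w; rewrite !big_seq1 /= fZl fZr.
Qed.

Lemma sweedler_pure v w : sweedler (pure v w) f = f v w.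
Proof. by rewrite /sweedler (sum_cong (tens_repr _)) big_seq1. Qed.

Lemma sweedler_is_linear : linear (fun x : tensor => sweedler x f).
Proof.
move=> a x y; rewrite -[x]reprK -[y]reprK tens_scaleE tens_addE.
rewrite /sweedler !(sum_cong (tens_repr _)) big_cat /= big_map scaler_sumr.
by congr (_ + _); apply: eq_bigr => p _ /=; rewrite fZl.
Qed.

End Lift.

Lemma tens_ext (U : lmodType K) (f g : {linear tensor -> U}) :
  (forall v w, f (pure v w) = g (pure v w)) -> f =1 g.
Proof.
move=> fg; apply: tens_ind => // [x y fx fy|]; first by rewrite !linearD fx fy.
by rewrite !linear0.
Qed.

End Tensor.

Arguments pure {K V W} v w : simpl never.
Arguments sweedler {K V W U} x f : simpl never.

Notation "V '\ox' W" := (tensor V W) : type_scope.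
Notation "v '\ot' w" := (pure v w) : ring_scope.
Notation "'\sw_' ( a , b <- t ) E" := (sweedler t (fun a b => E)) : ring_scope.

Section TensorMaps.
Context (K : fieldType).
Implicit Types (A B C D U V W : lmodType K).

Lemma sweedler_eq U V W (f g : V -> W -> U) (x : V \ox W) :
  (forall v w, f v w = g v w) -> sweedler x f = sweedler x g.
Proof. by move=> fg; apply: eq_bigr => p _; rewrite fg. Qed.

Lemma sweedler_linear_param U V W A (F : A -> V -> W -> U) (x : V \ox W) :
  (forall v w, linear (fun a => F a v w)) -> linear (fun a => sweedler x (F a)).
Proof.
move=> hF c a b; rewrite /sweedler scaler_sumr -big_split.
by apply: eq_bigr => p _; exact: hF.
Qed.

Lemma pure_linearl V W (w : W) : linear (fun v : V => v \ot w).
Proof. exact: (pure_bilinear V W).1. Qed.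

Lemma pure_linearr V W (v : V) : linear (fun w : W => v \ot w).
Proof. exact: (pure_bilinear V W).2. Qed.

Lemma pureDl V W (v1 v2 : V) (w : W) : (v1 + v2) \ot w = v1 \ot w + v2 \ot w.
Proof. by rewrite linearDl. Qed.

Lemma pureDr V W (v : V) (w1 w2 : W) : v \ot (w1 + w2) = v \ot w1 + v \ot w2.
Proof. by rewrite linearDr. Qed.

Lemma pure0l V W (w : W) : (0 : V) \ot w = 0.
Proof. by rewrite linear0l. Qed.

Lemma pure0r V W (v : V) : v \ot (0 : W) = 0.
Proof. by rewrite linear0r. Qed.

Section Tmap.
Context V V' W W' (f : V -> V') (g : W -> W').

Definition tmap (x : V \ox W) : V' \ox W' := \sw_(v, w <- x) f v \ot g w.

End Tmap.

Section TmapLinear.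
Context V V' W W' (f : {linear V -> V'}) (g : {linear W -> W'}).

Lemma tmap_bilinear : bilinear_for *:%R *:%R (fun v w => f v \ot g w).
Proof.
split=> [w|v] a x y /=; rewrite linearP; first exact: pure_linearl.
exact: pure_linearr.
Qed.

Lemma tmap_pure v w : tmap f g (v \ot w) = f v \ot g w.
Proof. exact: sweedler_pure tmap_bilinear _ _. Qed.

HB.instance Definition _ := GRing.isLinear.Build K (V \ox W) (V' \ox W') *:%R
  (tmap f g) (sweedler_is_linear tmap_bilinear).

End TmapLinear.

(* Identifications K (x) V = V = V (x) K. *)
Definition tunitl V (x : K^o \ox V) : V := \sw_(a, v <- x) (a : K) *: v.
Definition tunitr V (x : V \ox K^o) : V := \sw_(v, a <- x) (a : K) *: v.

Section Tunit.
Context V.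

Let bunitl : bilinear_for *:%R *:%R (fun (a : K^o) (v : V) => (a : K) *: v).
Proof.
split=> [v|a] c x y /=; first by rewrite scalerDl scalerA.
by rewrite scalerDr !scalerA mulrC.
Qed.

Let bunitr : bilinear_for *:%R *:%R (fun (v : V) (a : K^o) => (a : K) *: v).
Proof. by split=> [a|v]; [exact: bunitl.2|exact: bunitl.1]. Qed.

Lemma tunitl_pure (a : K^o) (v : V) : tunitl (a \ot v) = (a : K) *: v.
Proof. exact: (sweedler_pure bunitl). Qed.

Lemma tunitr_pure (v : V) (a : K^o) : tunitr (v \ot a) = (a : K) *: v.
Proof. exact: (sweedler_pure bunitr). Qed.

HB.instance Definition _ :=
  GRing.isLinear.Build K (K^o \ox V) V *:%R (@tunitl V) (sweedler_is_linear bunitl).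
HB.instance Definition _ :=
  GRing.isLinear.Build K (V \ox K^o) V *:%R (@tunitr V) (sweedler_is_linear bunitr).

End Tunit.

Definition tassoc U V W (x : (U \ox V) \ox W) : U \ox (V \ox W) :=
  \sw_(y, w <- x) \sw_(u, v <- y) u \ot (v \ot w).

Section Tassoc.
Context U V W.

Let bassoc1 (w : W) :
  bilinear_for *:%R *:%R (fun (u : U) (v : V) => u \ot (v \ot w)).
Proof.
split=> [v|u] a x y /=; first exact: pure_linearl.
by rewrite pure_linearl pure_linearr.
Qed.

Let bassoc2 : bilinear_for *:%R *:%R
  (fun (y : U \ox V) (w : W) => \sw_(u, v <- y) u \ot (v \ot w)).
Proof.
split=> [w|y]; first exact: (sweedler_is_linear (bassoc1 w)).
by apply: sweedler_linear_param => u v a x z /=; rewrite !pure_linearr.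
Qed.

Lemma tassoc_pure (u : U) (v : V) (w : W) :
  tassoc ((u \ot v) \ot w) = u \ot (v \ot w).
Proof. by rewrite /tassoc (sweedler_pure bassoc2) (sweedler_pure (bassoc1 w)). Qed.

HB.instance Definition _ :=
  GRing.isLinear.Build K ((U \ox V) \ox W) (U \ox (V \ox W)) *:%R
    (@tassoc U V W) (sweedler_is_linear bassoc2).

End Tassoc.

(* The map I (x) flip (x) I on four factors, with the target grouped in pairs. *)
Definition tmidflip A B C D (x : (A \ox B) \ox (C \ox D)) :
    (A \ox C) \ox (B \ox D) :=
  \sw_(y, z <- x) \sw_(a, b <- y) \sw_(c, d <- z) (a \ot c) \ot (b \ot d).

Section Tmidflip.
Context A B C D.

Let b1 (a : A) (b : B) : bilinear_for *:%R *:%R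
  (fun (c : C) (d : D) => (a \ot c) \ot (b \ot d)).
Proof.
split=> [d|c] k x y /=; first by rewrite pure_linearr pure_linearl.
by rewrite !pure_linearr.
Qed.

Let b2 (z : C \ox D) : bilinear_for *:%R *:%R
  (fun (a : A) (b : B) => \sw_(c, d <- z) (a \ot c) \ot (b \ot d)).
Proof.
split=> [b|a]; apply: sweedler_linear_param => c d k x y /=.
  by rewrite !pure_linearl.
by rewrite pure_linearl pure_linearr.
Qed.

Let b3 : bilinear_for *:%R *:%R (fun (y : A \ox B) (z : C \ox D) =>
  \sw_(a, b <- y) \sw_(c, d <- z) (a \ot c) \ot (b \ot d)).
Proof.
split=> [z|y]; first exact: (sweedler_is_linear (b2 z)).
by apply: sweedler_linear_param => a b; exact: (sweedler_is_linear (b1 a b)).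
Qed.

Lemma tmidflip_pure (a : A) (b : B) (c : C) (d : D) :
  tmidflip ((a \ot b) \ot (c \ot d)) = (a \ot c) \ot (b \ot d).
Proof.
by rewrite /tmidflip (sweedler_pure b3) (sweedler_pure (b2 _)) (sweedler_pure (b1 a b)).
Qed.

HB.instance Definition _ :=
  GRing.isLinear.Build K ((A \ox B) \ox (C \ox D)) ((A \ox C) \ox (B \ox D)) *:%R
    (@tmidflip A B C D) (sweedler_is_linear b3).

End Tmidflip.

End TensorMaps.

Arguments tmap {K V V' W W'} f g x : simpl never.
Arguments tunitl {K V} x : simpl never.
Arguments tunitr {K V} x : simpl never.
Arguments tassoc {K U V W} x : simpl never.
Arguments tmidflip {K A B C D} x : simpl never.

(* Unital associative algebras (A, m, u).  The library's algType is not used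
   because it excludes the zero algebra, which is a weak Hopf algebra. *)
HB.mixin Record Lmodule_isUAlgebra (K : fieldType) A of GRing.Lmodule K A := {
  mulmap : {linear A \ox A -> A};
  unitmap : {linear K^o -> A};
  mulmapA : forall x y z : A,
    mulmap (x \ot mulmap (y \ot z)) = mulmap (mulmap (x \ot y) \ot z);
  mulmap1l : forall x : A, mulmap (unitmap 1 \ot x) = x;
  mulmap1r : forall x : A, mulmap (x \ot unitmap 1) = x
}.

#[short(type="ualgType")]
HB.structure Definition UAlgebra (K : fieldType) :=
  {A of GRing.Lmodule K A & Lmodule_isUAlgebra K A}.

Notation "x '\m' y" := (mulmap (x \ot y)) : ring_scope.

Definition aone {K : fieldType} {A : ualgType K} : A := unitmap (1 : K^o).

Section UAlgebraTheory.
Context (K : fieldType) (A : ualgType K).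

Lemma mulmap_linearl (y : A) : linear (fun x : A => x \m y).
Proof. by move=> a x1 x2; rewrite pure_linearl linearP. Qed.

Lemma mulmap_linearr (x : A) : linear (fun y : A => x \m y).
Proof. by move=> a y1 y2; rewrite pure_linearr linearP. Qed.

End UAlgebraTheory.

Section AlgebraTensor.
Context (K : fieldType) (A B : ualgType K).

Definition tens_mul (x : (A \ox B) \ox (A \ox B)) : A \ox B :=
  tmap mulmap mulmap (tmidflip x).

Definition tens_unit (a : K^o) : A \ox B := (a : K) *: (aone \ot aone).

Lemma tens_mul_is_linear : linear tens_mul.
Proof. by move=> k x y; rewrite /tens_mul !linearP. Qed.

HB.instance Definition _ := GRing.isLinear.Build K ((A \ox B) \ox (A \ox B))
  (A \ox B) *:%R tens_mul tens_mul_is_linear.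

Lemma tens_unit_is_linear : linear tens_unit.
Proof. by move=> k a b; rewrite /tens_unit scalerDl -scalerA. Qed.

HB.instance Definition _ :=
  GRing.isLinear.Build K K^o (A \ox B) *:%R tens_unit tens_unit_is_linear.

Lemma tens_mul_pure a b c d :
  tens_mul ((a \ot b) \ot (c \ot d)) = (a \m c) \ot (b \m d).
Proof. by rewrite /tens_mul tmidflip_pure tmap_pure. Qed.

Lemma tens_mulA x y z :
  tens_mul (x \ot tens_mul (y \ot z)) = tens_mul (tens_mul (x \ot y) \ot z).
Proof.
elim/tens_ind: x => [a b|x1 x2 h1 h2|].
- elim/tens_ind: y => [c d|y1 y2 h1 h2|].
  + elim/tens_ind: z => [e f|z1 z2 h1 h2|].
    * by rewrite !tens_mul_pure !mulmapA.
    * by rewrite !(pureDr, linearD) /= h1 h2.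
    * by rewrite !(pure0r, linear0).
  + by rewrite !(pureDr, pureDl, linearD) /= h1 h2.
  + by rewrite !(pure0r, pure0l, linear0).
- by rewrite !(pureDl, linearD) /= h1 h2.
- by rewrite !(pure0l, linear0).
Qed.

Lemma tens_mul1l x : tens_mul (tens_unit 1 \ot x) = x.
Proof.
rewrite /tens_unit scale1r; elim/tens_ind: x => [a b|x y hx hy|].
- by rewrite tens_mul_pure !mulmap1l.
- by rewrite !(pureDr, linearD) /= hx hy.
- by rewrite pure0r linear0.
Qed.

Lemma tens_mul1r x : tens_mul (x \ot tens_unit 1) = x.
Proof.
rewrite /tens_unit scale1r; elim/tens_ind: x => [a b|x y hx hy|].
- by rewrite tens_mul_pure !mulmap1r.
- by rewrite !(pureDl, linearD) /= hx hy.
- by rewrite pure0l linear0.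
Qed.

HB.instance Definition _ := Lmodule_isUAlgebra.Build K (A \ox B)
  tens_mulA tens_mul1l tens_mul1r.

Lemma tens_mE (a c : A) (b d : B) :
  (a \ot b) \m (c \ot d) = (a \m c) \ot (b \m d).
Proof. exact: tens_mul_pure. Qed.

Lemma tens_aoneE : aone = aone \ot aone :> A \ox B.
Proof. exact: scale1r. Qed.

End AlgebraTensor.

HB.mixin Record Lmodule_isCoalgebra (K : fieldType) C of GRing.Lmodule K C := {
  comul : {linear C -> C \ox C};
  counit : {linear C -> K^o};
  comulA : forall c : C,
    tassoc (tmap comul idfun (comul c)) = tmap idfun comul (comul c);
  counitl : forall c : C, tunitl (tmap counit idfun (comul c)) = c;
  counitr : forall c : C, tunitr (tmap idfun counit (comul c)) = c
}.

#[short(type="coalgType")]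
HB.structure Definition Coalgebra (K : fieldType) :=
  {C of GRing.Lmodule K C & Lmodule_isCoalgebra K C}.

HB.mixin Record isWeakBialgebra (K : fieldType) H
    of UAlgebra K H & Coalgebra K H := {
  comulM : forall h k : H, comul (h \m k) = comul h \m comul k;
  counitM12 : forall h k l : H, counit (h \m k \m l) =
    \sw_(k1, k2 <- comul k) (counit (h \m k1) * counit (k2 \m l) : K^o);
  counitM21 : forall h k l : H, counit (h \m k \m l) =
    \sw_(k1, k2 <- comul k) (counit (h \m k2) * counit (k1 \m l) : K^o);
  comul1_12 :
    (aone \ot comul (aone : H)) \m tassoc (comul (aone : H) \ot (aone : H)) =
      tassoc (tmap comul idfun (comul (aone : H)));
  comul1_21 :
    tassoc (comul (aone : H) \ot (aone : H)) \m (aone \ot comul (aone : H)) =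
      tassoc (tmap comul idfun (comul (aone : H)))
}.

#[short(type="weakBialgType")]
HB.structure Definition WeakBialgebra (K : fieldType) :=
  {H of UAlgebra K H & Coalgebra K H & isWeakBialgebra K H}.

Section TargetSource.
Context (K : fieldType) (H : weakBialgType K).

Definition eps_t (h : H) : H :=
  \sw_(e1, e2 <- comul (aone : H)) (counit (e1 \m h) : K) *: e2.

Definition eps_s (h : H) : H :=
  \sw_(e1, e2 <- comul (aone : H)) (counit (h \m e2) : K) *: e1.

Lemma eps_t_is_linear : linear eps_t.
Proof.
apply: sweedler_linear_param => e1 e2 a x y /=.
by rewrite mulmap_linearr linearP scalerDl scalerA.
Qed.

Lemma eps_s_is_linear : linear eps_s.
Proof.
apply: sweedler_linear_param => e1 e2 a x y /=.
by rewrite mulmap_linearl linearP scalerDl scalerA.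
Qed.

HB.instance Definition _ := GRing.isLinear.Build K H H *:%R eps_t eps_t_is_linear.
HB.instance Definition _ := GRing.isLinear.Build K H H *:%R eps_s eps_s_is_linear.

End TargetSource.

Arguments eps_t {K H} h : simpl never.
Arguments eps_s {K H} h : simpl never.

HB.mixin Record isWeakHopf (K : fieldType) H of WeakBialgebra K H := {
  antipode : {linear H -> H};
  antipode_t : forall h : H, \sw_(h1, h2 <- comul h) h1 \m antipode h2 = eps_t h;
  antipode_s : forall h : H, \sw_(h1, h2 <- comul h) antipode h1 \m h2 = eps_s h;
  antipodeK : forall h : H,
    \sw_(h12, h3 <- tmap comul idfun (comul h))
      \sw_(h1, h2 <- h12) antipode h1 \m h2 \m antipode h3 = antipode h
}.

#[short(type="weakHopfType")]
HB.structure Definition WeakHopf (K : fieldType) :=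
  {H of WeakBialgebra K H & isWeakHopf K H}.

(* Main.v *)
From HB Require Import structures.
Require Import Defs.
From mathcomp Require Import all_boot all_algebra.

Set Implicit Arguments.
Unset Strict Implicit.

Import GRing.Theory.
Local Open Scope ring_scope.

(** Put [theta c = c^{-1} eps(c^0)], an element of [H].  Since tensoring with
    the ground field loses nothing, (CC4) says exactly that
    [theta c = eps_t (theta c)].

    Applying the counit of [C] to either leg of (CC2), and to the last leg of
    (CC3), gives the three identities
<<
      rho(c)           = theta(c_1) c_2^{-1} (x) c_2^0        (coaction_mull)
      rho(c)           = c_1^{-1} theta(c_2) (x) c_1^0        (coaction_mulr)
      Delta(theta(c))  = c^{-1} (x) theta(c^0)                (comul_theta)
>>
    The proof evaluates the element [theta(c_1) eps_t(theta(c_2))] in two ways.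

    On the one hand, [eps_t(h) = h_1 S(h_2)] and (comul_theta) give
    [eps_t(theta(c)) = c^{-1} S(theta(c^0))], so that
<<
      theta(c_1) eps_t(theta(c_2)) = theta(c_1) c_2^{-1} S(theta(c_2^0))
                                   = c^{-1} S(theta(c^0)) = eps_t(theta(c)),
>>
    by (coaction_mull).  On the other hand, every weak bialgebra satisfies
    [x eps_t(y) = eps(x_1 y) x_2] (mul_eps_t), so that
<<
      theta(c_1) eps_t(theta(c_2)) = eps(c_1^{-1} theta(c_2)) theta(c_1^0)
                                   = eps(c^{-1}) theta(c^0) = theta(c),
>>
    by (comul_theta), (coaction_mulr) and (CC1).

    Dually, this is the argument that [h . 1 = eps_t(h) . 1] in a module
    algebra over a weak Hopf algebra. *)

(** * Linear maps on tensor products *)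

Section TensorComplements.
Context {K : fieldType}.

(** A Sweedler sum runs over a chosen representative of the tensor; the linear
    map [F], which extends [f], shows that the choice does not matter. *)
Lemma sweedler_linear (V W U : lmodType K) (F : {linear V \ox W -> U})
    (f : V -> W -> U) (x : V \ox W) :
  (forall v w, F (v \ot w) = f v w) -> sweedler x f = F x.
Proof.
move=> Ff; rewrite [in RHS](tens_pure_sum x) linear_sum.
by apply: eq_bigr => p _; rewrite Ff.
Qed.

Lemma pureZl (V W : lmodType K) (a : K) (v : V) (w : W) :
  (a *: v) \ot w = a *: (v \ot w).
Proof. exact: (linearZl_LR pure). Qed.

Lemma pureZr (V W : lmodType K) (a : K) (v : V) (w : W) :
  v \ot (a *: w) = a *: (v \ot w).
Proof. exact: (linearZr_LR pure). Qed.

Lemma pure_suml (V W : lmodType K) I (r : seq I) (F : I -> V) (w : W) :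
  (\sum_(i <- r) F i) \ot w = \sum_(i <- r) F i \ot w.
Proof.
exact: (big_morph (fun v => v \ot w) (fun v v' => pureDl v v' w) (pure0l V w)).
Qed.

Lemma pure_sumr (V W : lmodType K) I (r : seq I) (v : V) (F : I -> W) :
  v \ot (\sum_(i <- r) F i) = \sum_(i <- r) v \ot F i.
Proof. exact: (big_morph (pure v) (pureDr v) (pure0r W v)). Qed.

(** Additivity is stated for each map by name: since [tmap] and the others are
    themselves sums over representatives, [linear_sum] may otherwise match a
    value of one of these maps, unfolded, as the sum to distribute over. *)
Lemma tmap_sum (V V' W W' : lmodType K) (f : {linear V -> V'})
    (g : {linear W -> W'}) I (r : seq I) (F : I -> V \ox W) :
  tmap f g (\sum_(i <- r) F i) = \sum_(i <- r) tmap f g (F i).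
Proof. exact: (linear_sum (tmap f g)). Qed.

Lemma tunitl_sum (V : lmodType K) I (r : seq I) (F : I -> K^o \ox V) :
  tunitl (\sum_(i <- r) F i) = \sum_(i <- r) tunitl (F i).
Proof. exact: (linear_sum tunitl). Qed.

Lemma tunitr_sum (V : lmodType K) I (r : seq I) (F : I -> V \ox K^o) :
  tunitr (\sum_(i <- r) F i) = \sum_(i <- r) tunitr (F i).
Proof. exact: (linear_sum tunitr). Qed.

Lemma tassoc_sum (U V W : lmodType K) I (r : seq I)
    (F : I -> (U \ox V) \ox W) :
  tassoc (\sum_(i <- r) F i) = \sum_(i <- r) tassoc (F i).
Proof. exact: (linear_sum tassoc). Qed.

Lemma tmidflip_sum (A B C D : lmodType K) I (r : seq I)
    (F : I -> (A \ox B) \ox (C \ox D)) :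
  tmidflip (\sum_(i <- r) F i) = \sum_(i <- r) tmidflip (F i).
Proof. exact: (linear_sum tmidflip). Qed.

Lemma tmap_comp (V V' V'' W W' W'' : lmodType K)
    (f : {linear V' -> V''}) (f' : {linear V -> V'})
    (g : {linear W' -> W''}) (g' : {linear W -> W'}) (x : V \ox W) :
  tmap f g (tmap f' g' x) = tmap (f \o f') (g \o g') x.
Proof.
move: x.
apply: (tens_ext (f := tmap f g \o tmap f' g') (g := tmap (f \o f') (g \o g'))).
by move=> v w /=; rewrite !tmap_pure.
Qed.

Lemma eq_tmap (V V' W W' : lmodType K) (f f' : V -> V') (g g' : W -> W')
    (x : V \ox W) : f =1 f' -> g =1 g' -> tmap f g x = tmap f' g' x.
Proof. by move=> ff gg; apply: sweedler_eq => v w; rewrite ff gg. Qed.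

Lemma tmap_id (V W : lmodType K) (x : V \ox W) : tmap idfun idfun x = x.
Proof.
by apply: (tens_ext (f := tmap idfun idfun) (g := idfun)) => v w /=;
  rewrite tmap_pure.
Qed.

Lemma tunitl_natural (V W : lmodType K) (f : {linear V -> W}) (x : K^o \ox V) :
  f (tunitl x) = tunitl (tmap idfun f x).
Proof.
move: x.
apply: (tens_ext (f := f \o tunitl) (g := tunitl \o tmap idfun f)) => a v /=.
by rewrite tmap_pure !tunitl_pure linearZ.
Qed.

Lemma tunitr_natural (V W : lmodType K) (f : {linear V -> W}) (x : V \ox K^o) :
  f (tunitr x) = tunitr (tmap f idfun x).
Proof.
move: x.
apply: (tens_ext (f := f \o tunitr) (g := tunitr \o tmap f idfun)) => v a /=.
by rewrite tmap_pure !tunitr_pure linearZ.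
Qed.

Lemma tunitr_inj (V : lmodType K) : injective (@tunitr K V).
Proof.
apply: (can_inj (g := fun v => v \ot (1 : K^o))) => x.
elim/tens_ind: x => [v a|x y hx hy|]; last by rewrite linear0 pure0l.
  by rewrite tunitr_pure linearZl_LR -linearZr_LR /= [_ *: _]mulr1.
by rewrite linearD pureDl hx hy.
Qed.

End TensorComplements.

(** * Weak bialgebras: multiplication by values of [eps_t] *)

Section Multiplications.
Context {K : fieldType} {A : ualgType K}.

Definition lmul (a x : A) : A := a \m x.
Definition rmul (a x : A) : A := x \m a.

HB.instance Definition _ (a : A) :=
  GRing.isLinear.Build K A A *:%R (lmul a) (@mulmap_linearr K A a).
HB.instance Definition _ (a : A) :=
  GRing.isLinear.Build K A A *:%R (rmul a) (@mulmap_linearl K A a).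

End Multiplications.

Lemma lmul_pure (K : fieldType) (A B : ualgType K) (a : A) (b : B) (x : A \ox B) :
  (a \ot b) \m x = tmap (lmul a) (lmul b) x.
Proof.
move: x; apply: (tens_ext (f := lmul (a \ot b))
  (g := tmap (lmul a) (lmul b))) => c d /=.
by rewrite tmap_pure /lmul tens_mE.
Qed.

Lemma eps_tE (K : fieldType) (H : weakBialgType K) (h : H) :
  eps_t h = tunitl (tmap (counit \o rmul h) idfun (comul (aone : H))).
Proof.
apply: (sweedler_linear (F := tunitl \o tmap (counit \o rmul h) idfun)) => a b.
by rewrite /= tmap_pure tunitl_pure.
Qed.

Lemma eps_t_antipode (K : fieldType) (H : weakHopfType K) (h : H) :
  eps_t h = mulmap (tmap idfun antipode (comul h)).
Proof.
rewrite -antipode_t.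
apply: (sweedler_linear (F := mulmap \o tmap idfun antipode)) => a b.
by rewrite /= tmap_pure.
Qed.

(** Both sides equal [eps(1_1 y) eps(x_1 1_2) x_2 1_3]: on the left because
    [x 1_2 = eps(x_1 1_2) x_2 1_3] by the counit axiom, on the right because
    the axiom [eps(hkl) = eps(h k_2) eps(k_1 l)], for [k = 1_1], splits
    [eps(x_1 y) x_2 = eps(x_1 1_1 y) x_2 1_2]. *)
Lemma mul_eps_t (K : fieldType) (H : weakBialgType K) (x y : H) :
  x \m eps_t y = tunitl (tmap (counit \o rmul y) idfun (comul x)).
Proof.
pose s := repr (comul x).
have sE : comul x = \sum_(p <- s) p.1 \ot p.2 by exact: tens_pure_sum.
pose u := repr (comul (aone : H)).
have uE : comul aone = \sum_(q <- u) q.1 \ot q.2 by exact: tens_pure_sum.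
have comulE z :
    comul (x \m z) = \sum_(p <- s) tmap (lmul p.1) (lmul p.2) (comul z).
  rewrite comulM sE pure_suml linear_sum.
  by apply: eq_bigr => p _; rewrite lmul_pure.
(* For p = (a, b), Psi p sends k (x) l to eps(a k) b l. *)
pose Psi (p : H * H) : {linear H \ox H -> H} :=
  tunitl \o tmap (counit \o lmul p.1) (lmul p.2).
have mulE z : lmul x z = \sum_(p <- s) Psi p (comul z).
  rewrite -[lmul x z]counitl comulE tmap_sum tunitl_sum.
  by apply: eq_bigr => p _; rewrite /= tmap_comp.
have -> : comul x = \sum_(p <- s) tmap (lmul p.1) (lmul p.2) (comul (aone : H)).
  by rewrite -comulE mulmap1r.
(* This is x eps_t(y) = eps(1_1 y) eps(x_1 1_2) x_2 1_3. *)
have -> : x \m eps_t y = \sum_(p <- s)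
    tunitl (tmap (counit \o rmul y) (Psi p) (tmap idfun comul (comul (aone : H)))).
  rewrite eps_tE -[LHS]/(lmul x _) tunitl_natural tmap_comp.
  rewrite uE tmap_sum tunitl_sum.
  under [RHS]eq_bigr do rewrite (tmap_sum idfun comul) tmap_sum tunitl_sum.
  rewrite [RHS]exchange_big; apply: eq_bigr => q _.
  rewrite tmap_pure tunitl_pure /= mulE scaler_sumr; apply: eq_bigr => p _.
  by rewrite !tmap_pure tunitl_pure.
rewrite tmap_sum tunitl_sum; apply: eq_bigr => p _ /=.
(* The Sweedler components of 1 are now read as (1_1)_1, (1_1)_2 and 1_2, so that
   the axiom on eps(hkl) applies with 1_1 in the middle. *)
rewrite -comulA tmap_comp.
apply: (tens_ext
  (f := tunitl \o tmap (counit \o rmul y) (Psi p) \o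
        tassoc \o tmap comul idfun)
  (g := tunitl \o tmap (counit \o rmul y \o lmul p.1) (idfun \o lmul p.2)))
  => a b /=.
rewrite !tmap_pure /= tunitl_pure {1}[comul a]tens_pure_sum.
rewrite pure_suml tassoc_sum tmap_sum tunitl_sum.
have -> : counit (rmul y (lmul p.1 a)) = counit (p.1 \m a \m y) by [].
rewrite counitM21 scaler_suml; apply: eq_bigr => k _.
rewrite tassoc_pure tmap_pure tunitl_pure /= tmap_pure tunitl_pure scalerA.
by rewrite mulrC.
Qed.

(** * Weak comodule coalgebras *)

(** With [rho(c)] for [x] and [rho(d)] for [y], the two lemmas below apply the
    counit of [C] to one leg of the right-hand side of (CC2). *)
Section CounitLegs.
Context (K : fieldType) (H : ualgType K) (C : coalgType K).
Implicit Types x y : H \ox C.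

Lemma counit_mull x y :
  tmap idfun (tunitl \o tmap counit idfun)
    (tmap mulmap idfun (tmidflip (x \ot y))) =
  tmap (lmul (tunitr (tmap idfun counit x))) idfun y.
Proof.
move: (repr y) (tens_pure_sum y) => s ->.
rewrite pure_sumr tmidflip_sum (tmap_sum mulmap idfun) !tmap_sum.
apply: eq_bigr => -[k d] _; rewrite tmap_pure /=.
move: (repr x) (tens_pure_sum x) => r ->.
rewrite pure_suml tmidflip_sum (tmap_sum mulmap idfun) tmap_sum.
rewrite (tmap_sum idfun counit) tunitr_sum /lmul pure_suml (linear_sum mulmap).
rewrite pure_suml; apply: eq_bigr => -[h c] _.
rewrite tmidflip_pure !tmap_pure /= tmap_pure tunitl_pure tunitr_pure.
by rewrite pureZl pureZr linearZ /= pureZl.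
Qed.

Lemma counit_mulr x y :
  tmap idfun (tunitr \o tmap idfun counit)
    (tmap mulmap idfun (tmidflip (x \ot y))) =
  tmap (rmul (tunitr (tmap idfun counit y))) idfun x.
Proof.
move: (repr x) (tens_pure_sum x) => r ->.
rewrite pure_suml tmidflip_sum (tmap_sum mulmap idfun) !tmap_sum.
apply: eq_bigr => -[h c] _; rewrite tmap_pure /=.
move: (repr y) (tens_pure_sum y) => s ->.
rewrite pure_sumr tmidflip_sum (tmap_sum mulmap idfun) tmap_sum.
rewrite (tmap_sum idfun counit) tunitr_sum /rmul pure_sumr (linear_sum mulmap).
rewrite pure_suml; apply: eq_bigr => -[k d] _.
rewrite tmidflip_pure !tmap_pure /= tmap_pure !tunitr_pure.
by rewrite !pureZr linearZ /= pureZl.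
Qed.

End CounitLegs.

Section Coaction.
Context (K : fieldType) (H : weakHopfType K) (C : coalgType K).
Context (rho : {linear C -> H \ox C}).
Context (CC1 : forall c : C, tunitl (tmap counit idfun (rho c)) = c).
Context (CC2 : forall c : C,
  tmap idfun comul (rho c) =
  tmap mulmap idfun (tmidflip (tmap rho rho (comul c)))).
Context (CC3 : forall c : C,
  tmap idfun rho (rho c) = tassoc (tmap comul idfun (rho c))).

Let theta : {linear C -> H} := tunitr \o tmap idfun counit \o rho.

(** This is (CC3) with the counit of [C] applied to the last leg. *)
Lemma comul_theta c : comul (theta c) = tmap idfun theta (rho c).
Proof.
have -> : tmap idfun theta (rho c) =
    tmap idfun (tunitr \o tmap idfun counit) (tmap idfun rho (rho c)).
  by rewrite tmap_comp; apply: eq_tmap.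
rewrite CC3 /= tunitr_natural tmap_comp; move: (rho c).
apply: (tens_ext (U := H \ox H)
  (f := tunitr \o tmap (comul \o idfun) (idfun \o counit))
  (g := tmap idfun (tunitr \o tmap idfun counit) \o (tassoc \o
     tmap comul idfun))) => h c' /=.
rewrite !tmap_pure /= tunitr_pure.
rewrite {2}[comul h]tens_pure_sum pure_suml tassoc_sum tmap_sum.
rewrite {1}[comul h]tens_pure_sum scaler_sumr; apply: eq_bigr => k _.
rewrite tassoc_pure tmap_pure /= tmap_pure tunitr_pure /=.
by rewrite pureZr.
Qed.

(** The first leg of (CC2) in [C] is killed by the counit: on the left this gives
    back [rho(c)], by the counit law of [C]. *)
Lemma coaction_mull c : rho c =
  \sum_(p <- repr (comul c)) tmap (lmul (theta p.1)) idfun (rho p.2).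
Proof.
have {1}-> : rho c =
    tmap idfun (tunitl \o tmap counit idfun) (tmap idfun comul (rho c)).
  rewrite tmap_comp -[LHS]tmap_id; apply: eq_tmap => // d /=.
  by rewrite counitl.
rewrite CC2 {1}[comul c]tens_pure_sum (tmap_sum rho rho) tmidflip_sum.
rewrite (tmap_sum mulmap idfun) tmap_sum; apply: eq_bigr => p _.
by rewrite tmap_pure counit_mull.
Qed.

(** The same with the second leg of (CC2) in [C]. *)
Lemma coaction_mulr c : rho c =
  \sum_(p <- repr (comul c)) tmap (rmul (theta p.2)) idfun (rho p.1).
Proof.
have {1}-> : rho c =
    tmap idfun (tunitr \o tmap idfun counit) (tmap idfun comul (rho c)).
  rewrite tmap_comp -[LHS]tmap_id; apply: eq_tmap => // d /=.
  by rewrite counitr.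
rewrite CC2 {1}[comul c]tens_pure_sum (tmap_sum rho rho) tmidflip_sum.
rewrite (tmap_sum mulmap idfun) tmap_sum; apply: eq_bigr => p _.
by rewrite tmap_pure counit_mulr.
Qed.

(** Both sides are values of [theta(c_1) eps_t(theta(c_2))]: the left one by the
    antipode axiom and [coaction_mull], the right one by [mul_eps_t] and
    [coaction_mulr]. *)
Lemma eps_t_theta c : eps_t (theta c) = theta c.
Proof.
have eps_thetaE d :
    eps_t (theta d) = mulmap (tmap idfun (antipode \o theta) (rho d)).
  by rewrite eps_t_antipode comul_theta tmap_comp.
transitivity (\sum_(p <- repr (comul c)) theta p.1 \m eps_t (theta p.2)).
  rewrite eps_thetaE coaction_mull tmap_sum (linear_sum mulmap).
  apply: eq_bigr => p _; rewrite eps_thetaE tmap_comp.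
  move: (rho p.2).
  apply: (tens_ext
    (f := mulmap \o
          tmap (idfun \o lmul (theta p.1)) (antipode \o theta \o idfun))
    (g := lmul (theta p.1) \o mulmap \o tmap idfun (antipode \o theta))) => h d.
  by rewrite /= !tmap_pure /lmul /= mulmapA.
under eq_bigr => p _ do rewrite mul_eps_t comul_theta tmap_comp.
rewrite -{2}[c]CC1 tunitl_natural coaction_mulr.
rewrite (tmap_sum counit idfun) tmap_sum tunitl_sum.
by apply: eq_bigr => p _; rewrite !tmap_comp.
Qed.

End Coaction.

Theorem proposition3p1 (K : fieldType) (H : weakHopfType K) (C : coalgType K)
  (rho : {linear C -> H \ox C})
  (CC1 : forall c : C, tunitl (tmap counit idfun (rho c)) = c)
  (CC2 : forall c : C,
     tmap idfun comul (rho c) =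
     tmap mulmap idfun (tmidflip (tmap rho rho (comul c))))
  (CC3 : forall c : C,
     tmap idfun rho (rho c) = tassoc (tmap comul idfun (rho c))) :
  forall c : C, tmap idfun counit (rho c) = tmap eps_t counit (rho c).
Proof.
move=> c; apply: tunitr_inj.
have -> : tmap eps_t counit (rho c) =
    tmap eps_t idfun (tmap idfun counit (rho c)).
  by rewrite tmap_comp; apply: eq_tmap.
rewrite -tunitr_natural; symmetry; exact: (eps_t_theta CC1 CC2 CC3).
Qed.
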